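(* Each indecomposable solution of multipermutation level at most $2$ is a homomorphic image of the universal indecomposable solution of multipermutation level $2$; that is, for every such solution $(X,\sigma,\tau)$ there is a surjective homomorphism of solutions from the universal solution onto $(X,\sigma,\tau)$.
   Context: A solution $(X,\sigma,\tau)$ is a nonempty set $X$ (of arbitrary cardinality) with families of bijections $\sigma_x,\tau_x:X\to X$ ($x\in X$) such that $r(x,y)=(\sigma_x(y),\tau_y(x))$ satisfies $(\mathrm{id}\times r)(r\times\mathrm{id})(\mathrm{id}\times r)=(r\times\mathrm{id})(\mathrm{id}\times r)(r\times\mathrm{id})$ on $X^3$. It is indecomposable if $\mathcal{G}(X)=\langle\sigma_x,\tau_x: x\in X\rangle$ acts transitively on $X$. Put $x\approx y$ iff $\sigma_x=\sigma_y$ and $\tau_x=\tau_y$. The operations induced on $X/{\approx}$ are well defined and give a solution $\mathrm{Ret}(X)$. $X$ has multipermutation level at most $2$ if $|\mathrm{Ret}(\mathrm{Ret}(X))|=1$. A homomorphism $\Phi:(Y,\lambda,\rho)\to(X,\sigma,\tau)$ is a map with $\Phi\lambda_y=\sigma_{\Phi(y)}\Phi$ and $\Phi\rho_y=\tau_{\Phi(y)}\Phi$ for all $y\in Y$. The universal indecomposable solution of multipermutation level $2$: let $F=\bigoplus_{\mathbb{Z}}\mathbb{Z}$ be the free abelian group of countably infinite rank with a free basis that is the disjoint union of $\{e_i\mid i\in\mathbb{Z}\}$ and $\{f_i\mid i\in\mathbb{Z}\}$. Put $c_i=\sum_{k=1}^{i}e_k$ for $i>0$, $c_0=0$, $c_i=-\sum_{k=i+1}^{0}e_k$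 for $i<0$, and likewise $d_i=\sum_{k=1}^{i}f_k$ for $i>0$, $d_0=0$, $d_i=-\sum_{k=i+1}^{0}f_k$ for $i<0$. The universal solution is $(F\times\mathbb{Z}^2,\lambda,\rho)$ with $\lambda_{(a,i,i')}((b,j,j'))=(b+c_{i-i'+j'-j-1},j+1,j')$ and $\rho_{(a,i,i')}((b,j,j'))=(b+d_{i-i'+j'-j+1},j,j'+1)$. *)

(* Defs.v *)
From HB Require Import structures.
From mathcomp Require Import all_boot all_algebra.
From mathcomp Require Import boolp.
From mathcomp Require Import freeg.
From mathcomp Require Import zify.

Set Implicit Arguments.
Unset Strict Implicit.
Unset Printing Implicit Defensive.

Import GRing.Theory.
Local Open Scope ring_scope.
Local Open Scope quotient_scope.

(* Two families of self-maps of a type, without axioms, so that the retract is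
   available before it is known to be a solution; [sigma x y] is sigma_x(y) and
   [tau x y] is tau_x(y). *)
Record presolution := Presolution {
  carrier :> Type;
  sigma : carrier -> carrier -> carrier;
  tau : carrier -> carrier -> carrier
}.

Section Solutions.
Variable X : presolution.

Definition rmap (p : X * X) : X * X := (sigma p.1 p.2, tau p.2 p.1).

Definition r_id (t : X * X * X) : X * X * X :=
  let: (x, y, z) := t in let: (x', y') := rmap (x, y) in (x', y', z).

Definition id_r (t : X * X * X) : X * X * X :=
  let: (x, y, z) := t in let: (y', z') := rmap (y, z) in (x, y', z').

Definition solution : Prop :=
  [/\ inhabited X,
      forall x : X, bijective (sigma x),
      forall x : X, bijective (tau x)
    & forall t, id_r (r_id (id_r t)) = r_id (id_r (r_id t))].

(* The subgroup of Sym(X) generated by all sigma_x and tau_x. *)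
Inductive perm_group : (X -> X) -> Prop :=
| perm_group_id : perm_group id
| perm_group_sigma x : perm_group (sigma x)
| perm_group_tau x : perm_group (tau x)
| perm_group_comp g h : perm_group g -> perm_group h -> perm_group (g \o h)
| perm_group_inv g h :
    perm_group g -> cancel g h -> cancel h g -> perm_group h.

Definition indecomposable : Prop :=
  forall x y : X, exists2 g, perm_group g & g x = y.

Definition approx (x y : {classic X}) : bool :=
  `[< sigma (x : X) = sigma (y : X) /\ tau (x : X) = tau (y : X) >].

Lemma approx_refl : reflexive approx.
Proof. by move=> x; apply/asboolP. Qed.

Lemma approx_sym : symmetric approx.
Proof. by move=> x y; apply: asbool_equiv_eq; split=> -[-> ->]. Qed.

Lemma approx_trans : transitive approx.
Proof.
by move=> y x z /asboolP[sxy txy] /asboolP[syz tyz]; apply/asboolP; rewrite sxy txy.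
Qed.

Canonical approx_equiv := EquivRel approx approx_refl approx_sym approx_trans.

Definition retract := {eq_quot approx}.

(* [lift_op2] evaluates on chosen representatives; [sigma_Ret] and [tau_Ret]
   below show that for a solution the choice is immaterial. *)
Definition Ret : presolution :=
  @Presolution retract
    (lift_op2 retract (@sigma X : {classic X} -> {classic X} -> {classic X}))
    (lift_op2 retract (@tau X : {classic X} -> {classic X} -> {classic X})).

End Solutions.

Definition singleton (T : Type) : Prop := exists a : T, forall b : T, b = a.

Definition mpl_le2 (X : presolution) : Prop := singleton (Ret (Ret X)).

Definition homomorphism (Y X : presolution) (Phi : Y -> X) : Prop :=
  (forall y z, Phi (sigma y z) = sigma (Phi y) (Phi z)) /\
  (forall y z, Phi (tau y z) = tau (Phi y) (Phi z)).

Lemma ybeP (X : presolution) :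
  (forall t : X * X * X, id_r (r_id (id_r t)) = r_id (id_r (r_id t))) <->
  (forall x y z : X,
    [/\ sigma x (sigma y z) = sigma (sigma x y) (sigma (tau y x) z),
        tau (sigma (tau y x) z) (sigma x y) =
          sigma (tau (sigma y z) x) (tau z y)
      & tau z (tau y x) = tau (tau z y) (tau (sigma y z) x)]).
Proof.
split=> [ybe x y z|ybe [[x y] z]]; last first.
  by rewrite /id_r /r_id /rmap /=; case: (ybe x y z) => -> -> ->.
by have [] := ybe (x, y, z).
Qed.

Lemma approx_op (X : presolution) (x x' y y' : X) : solution X ->
  approx x x' -> approx y y' ->
  approx (sigma x y) (sigma x' y') /\ approx (tau x y) (tau x' y').
Proof.
case=> _ sbij tbij /ybeP ybe /asboolP[sx tx] /asboolP[sy ty].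
rewrite -sx -tx.
have es (a b : X) :
    sigma a \o sigma b = sigma (sigma a b) \o sigma (tau b a).
  by apply: funext => z /=; have [] := ybe a b z.
have et (a b : X) : tau b \o tau a = tau (tau b a) \o tau (sigma a b).
  by apply: funext => z /=; have [] := ybe z a b.
have cancelR (g g' h : X -> X) : bijective h -> g \o h = g' \o h -> g = g'.
  move=> [k hK kK] eq_gg'; apply: funext => u; rewrite -(kK u).
  by have := congr1 (@^~ (k u)) eq_gg'.
have cancelL (g g' h : X -> X) : bijective h -> h \o g = h \o g' -> g = g'.
  move=> [k hK kK] eq_gg'; apply: funext => u; apply: (can_inj hK).
  by have := congr1 (@^~ u) eq_gg'.
split; apply/asboolP; split.
- apply: (cancelR _ _ (sigma (tau y x))) => //.
  by rewrite -es {1}ty -es sy.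
- apply: (cancelL _ _ (tau (tau y x))) => //.
  by rewrite -et ty -et.
- apply: (cancelL _ _ (sigma (sigma y x))) => //.
  by rewrite -es sy -es.
- apply: (cancelR _ _ (tau (sigma y x))) => //.
  by rewrite -et {1}sy -et ty.
Qed.

Section RetractOperations.
Variables (X : presolution) (solX : solution X).

Let approx_repr (x : {classic X}) : approx (repr (\pi_(retract X) x)) x.
Proof. by apply/eqmodP; exact: reprK. Qed.

Lemma sigma_Ret (x y : {classic X}) :
  @sigma (Ret X) (\pi_(retract X) x) (\pi_(retract X) y) =
  \pi_(retract X) (@sigma X x y : {classic X}).
Proof.
rewrite /= -lock; apply/eqmodP.
exact: (approx_op solX (approx_repr x) (approx_repr y)).1.
Qed.

Lemma tau_Ret (x y : {classic X}) :
  @tau (Ret X) (\pi_(retract X) x) (\pi_(retract X) y) =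
  \pi_(retract X) (@tau X x y : {classic X}).
Proof.
rewrite /= -lock; apply/eqmodP.
exact: (approx_op solX (approx_repr x) (approx_repr y)).2.
Qed.

End RetractOperations.

(* The free abelian group on the disjoint union of two copies of int. *)
Local Notation F := {freeg (int + int)%type}.

Definition basis_e (i : int) : F := << (inl i : (int + int)%type) >>.
Definition basis_f (i : int) : F := << (inr i : (int + int)%type) >>.

(* In the second case i = - n.+1, so that k = - m runs from i + 1 = - n to 0. *)
Definition partial_sum (g : int -> F) (i : int) : F :=
  match i with
  | Posz n => \sum_(1 <= k < n.+1) g k%:Z
  | Negz n => - \sum_(0 <= m < n.+1) g (- m%:Z)
  end.

Definition offset_c : int -> F := partial_sum basis_e.
Definition offset_d : int -> F := partial_sum basis_f.

Definition universal_solution : presolution :=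
  @Presolution (F * (int * int))
    (fun x y => let: (a, (i, i')) := x in let: (b, (j, j')) := y in
      (b + offset_c (i - i' + j' - j - 1), (j + 1, j')))
    (fun x y => let: (a, (i, i')) := x in let: (b, (j, j')) := y in
      (b + offset_d (i - i' + j' - j + 1), (j, j' + 1))).

Lemma partial_sumS g i : partial_sum g (i + 1) = partial_sum g i + g (i + 1).
Proof.
case: i => [n|[|n]].
- have -> : Posz n + 1 = Posz n.+1 by lia.
  by rewrite /= (big_nat_recr n.+1).
- by rewrite /= big_nil big_nat1 addNr.
- have -> : Negz n.+1 + 1 = Negz n by lia.
  rewrite /= (big_nat_recr n.+1) //= opprD -addrA.
  by rewrite -NegzE (_ : Negz n = - n.+1%:Z) // addNr addr0.
Qed.

Lemma universal_solutionP : solution universal_solution.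
Proof.
split.
- by split; exact: (0, (0, 0)).
- move=> [a [i i']].
  exists (fun y => let: (b, (j, j')) := y in
            (b - offset_c (i - i' + j' - j), (j - 1, j'))).
  + move=> [b [j j']] /=; rewrite (_ : _ - (j + 1) = i - i' + j' - j - 1);
      last by lia.
    by rewrite !addrK.
  + move=> [b [j j']] /=; rewrite (_ : _ - 1 = i - i' + j' - j); last by lia.
    by rewrite !subrK.
- move=> [a [i i']].
  exists (fun y => let: (b, (j, j')) := y in
            (b - offset_d (i - i' + j' - j), (j, j' - 1))).
  + move=> [b [j j']] /=.
    rewrite (_ : i - i' + (j' + 1) - j = i - i' + j' - j + 1); last by lia.
    by rewrite !addrK.
  + move=> [b [j j']] /=.
    rewrite (_ : i - i' + (j' - 1) - j + 1 = i - i' + j' - j); last by lia.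
    by rewrite !subrK.
- apply/ybeP => -[a [i i']] [b [j j']] [u [k k']] /=; split.
  + rewrite -!addrA; congr (_ + _, _); rewrite addrC.
    by congr (offset_c _ + offset_c _); lia.
  + rewrite -!addrA; congr (_ + _, _); rewrite addrC.
    by congr (offset_d _ + offset_c _); lia.
  + rewrite -!addrA; congr (_ + _, _); rewrite addrC.
    by congr (offset_d _ + offset_d _); lia.
Qed.

(* Main.v *)
From HB Require Import structures.
From mathcomp Require Import all_boot all_algebra.
From mathcomp Require Import boolp.
From mathcomp Require Import freeg.
From mathcomp Require Import zify.
Require Import Defs.

(** Let p : X -> Ret(X) be the projection.  Multipermutation level at most 2
    says that sigma_x and tau_x act on Ret(X) by permutations S and T that do
    not depend on x.  The Yang-Baxter equation at a point x = sigma_y(y) then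
    reads sigma_y = sigma_(T S y), and similarly for tau, so that T is the
    inverse of S ([tau_sigma], [sigma_tau]).  By indecomposability Ret(X) is a
    single orbit of S, and all that sigma_x(y) depends on, besides y, is the
    difference k with p(x) = S^k p(y).  Hence it is natural to look at the maps

      B_k : y |-> sigma_(S^k y)(y)   and   E_k : y |-> tau_(S^k y)(y).

    Here B_k B_l y = sigma_(S^(k+1) y) (sigma_(S^l y) (y)), and the Yang-Baxter
    equation for these two subscripts says precisely that this equals
    B_l B_k y; in the same way E_k E_l = E_l E_k and E_k B_l = B_l E_k
    ([twist_commute]).  These maps are bijective ([twist_bij]), so they
    lie in an abelian group M of permutations of X
    ([commuting_permutations_zmod]).

    In the universal solution the corresponding maps are translations of the
    abelian group F x Z^2: B_k is the translation by (c_(k-1), 1, 0) and E_k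
    the one by (d_(k+1), 0, 1).  So let W : F x Z^2 -> M be the homomorphism
    that matches them:

      e_i |-> B_(i+1) - B_i,      f_i |-> E_(i-1) - E_(i-2),
      (0, 1, 0) |-> B_1,          (0, 0, 1) |-> E_(-1).

    Telescoping gives W (c_(k-1), 1, 0) = B_k and W (d_(k+1), 0, 1) = E_k.
    With a base point x0, Phi(y) = W(y) . x0 is the required map: B_k raises
    the class in Ret(X) by S and E_k lowers it, so p(Phi(b, j, j')) =
    S^(j-j') p(x0), and therefore sigma_(Phi y) acts on Phi z as B_k for the
    same k for which lambda_y acts on z as the translation by
    (c_(k-1), 1, 0).  The image of Phi meets every class of Ret(X), so it is
    stable under all sigma_x, tau_x and their inverses, and it is all of X by
    indecomposability. *)

Set Implicit Arguments.
Unset Strict Implicit.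
Unset Printing Implicit Defensive.

Import GRing.Theory.
Local Open Scope ring_scope.
Local Open Scope quotient_scope.

(** * Abelian groups generated by commuting permutations *)

Section CommutingPermutations.
Variables (T K : Type) (A : K -> T -> T).

Definition centralizes (h : T -> T) : Prop := forall k x, h (A k x) = A k (h x).

(** The permutations in the bicommutant of a commuting family of permutations
    include the family and commute with each other.  Unlike the subgroup
    generated by the family they are described without words in the
    generators, and stability under products and inverses is immediate. *)
Record bicommutant := Bicommutant {
  perm :> T -> T;
  perm_inv : T -> T;
  permK : cancel perm perm_inv;
  perm_invK : cancel perm_inv perm;
  perm_comm : forall h, centralizes h -> forall x, h (perm x) = perm (h x)
}.

Lemma bicommutant_inj (f g : bicommutant) : perm f =1 perm g -> f = g.
Proof.
case: f g => [f f' fK f'K fC] [g g' gK g'K gC] /= /funext fg.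
rewrite -{g}fg in gK g'K gC *.
have gf' : f' = g' by apply: funext => x; rewrite -[x in g' x]f'K gK.
rewrite -{g'}gf' in gK g'K *.
by rewrite (Prop_irrelevance gK fK) (Prop_irrelevance g'K f'K)
  (Prop_irrelevance gC fC).
Qed.

Lemma commuting_permutations_zmod :
  (forall k, bijective (A k)) -> (forall k, centralizes (A k)) ->
  exists (M : zmodType) (act : M -> T -> T) (gen : K -> M),
    [/\ forall x, act 0 x = x,
        forall a b x, act (a + b) x = act a (act b x)
      & forall k, act (gen k) = A k].
Proof.
move=> Abij Acomm.
have one_comm h : centralizes h -> forall x : T, h (id x) = id (h x) by [].
pose one : bicommutant := @Bicommutant id id (fun=> erefl) (fun=> erefl) one_comm.
have mulK (f g : bicommutant) :
    cancel (f \o g) (perm_inv g \o perm_inv f).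
  by move=> x /=; rewrite !permK.
have mul_invK (f g : bicommutant) :
    cancel (perm_inv g \o perm_inv f) (f \o g).
  by move=> x /=; rewrite !perm_invK.
have mul_comm (f g : bicommutant) h :
    centralizes h -> forall x, h ((f \o g) x) = (f \o g) (h x).
  by move=> hA x /=; rewrite (perm_comm f hA) (perm_comm g hA).
pose mul (f g : bicommutant) : bicommutant :=
  @Bicommutant (f \o g) (perm_inv g \o perm_inv f)
    (mulK f g) (mul_invK f g) (mul_comm f g).
have inv_comm (f : bicommutant) h :
    centralizes h -> forall x, h (perm_inv f x) = perm_inv f (h x).
  by move=> hA x; apply: (can_inj (permK f)); rewrite -(perm_comm f hA) !perm_invK.
pose inv (f : bicommutant) : bicommutant :=
  @Bicommutant (perm_inv f) f (perm_invK f) (permK f) (inv_comm f).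
have mulA : associative mul by move=> f g h; apply: bicommutant_inj.
have mulC : commutative mul.
  (* Each A k centralizes the family, so f commutes with A k; thus f itself
     centralizes the family and commutes with g. *)
  move=> f g; apply: bicommutant_inj => x /=; apply: perm_comm => k y.
  exact/esym/(perm_comm f).
have mul1 : left_id one mul by move=> f; apply: bicommutant_inj.
have mulV : left_inverse one inv mul.
  by move=> f; apply: bicommutant_inj => x /=; rewrite permK.
pose C : choiceType := HB.pack bicommutant (gen_eqMixin bicommutant)
  (gen_choiceMixin bicommutant).
pose M : zmodType := HB.pack C
  (@GRing.isZmodule.Build C one inv mul mulA mulC mul1 mulV).
have gen_exists k : exists f : bicommutant, perm f = A k.
  have [A' AK A'K] := Abij k.
  by exists (Bicommutant AK A'K (fun h hA x => hA k x)).
have [gen genE] := choice gen_exists.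
by exists M, perm, gen.
Qed.

End CommutingPermutations.

(** * Homomorphisms out of a free abelian group *)

Section FreeAbelianLift.
Variables (K : choiceType) (M : zmodType) (f : K -> M).

(** The closure clause replaces a description of the image: it transfers to
    L a any property that defines a subgroup and holds for the generators. *)
Lemma freeg_lift :
  exists L : {freeg K} -> M,
    [/\ forall a b, L (a + b) = L a + L b,
        forall k, L << k >> = f k
      & forall S : M -> Prop, S 0 -> (forall a b, S a -> S b -> S (a - b)) ->
          (forall k, S (f k)) -> forall a, S (L a)].
Proof.
pose L : {freeg K} -> M := fglift (f : K -> zmodule M).
have LB a b : L (a - b) = L a - L b by exact: (lift_is_additive (f : K -> zmodule M)).
have LU k c : L << c *g k >> = f k *~ c by exact: (liftU (f : K -> zmodule M)).
have L0 : L 0 = 0 by rewrite -[in LHS](subrr 0) LB subrr.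
have LN a : L (- a) = - L a by rewrite -[in LHS](sub0r a) LB L0 sub0r.
have LD a b : L (a + b) = L a + L b by rewrite -[in LHS](opprK b) LB LN opprK.
exists L; split=> [||S S0 SB Sf a] //.
have SN m : S m -> S (- m) by move=> Sm; rewrite -sub0r; apply: SB.
have SD m n : S m -> S n -> S (m + n).
  by move=> Sm Sn; rewrite -(opprK n); apply: SB => //; apply: SN.
elim/freeg_ind_dom0: a => [|c k a _ _ Sa]; first by rewrite L0.
rewrite LD LU; apply: (SD _ _ _ Sa); elim/int_ind: c => [|n IHn|n IHn].
- by rewrite mulr0z.
- by rewrite intS mulrzDr mulr1z; apply: SD.
- by rewrite intS opprD mulrzDr mulrN1z addrC; apply: SB.
Qed.

End FreeAbelianLift.

(** The negative indices need no separate computation: by [partial_sumS] both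
    sides satisfy the same recurrence on all of int, and both vanish at 0. *)
Lemma partial_sum_telescope (M : zmodType) (L : {freeg (int + int)} -> M)
    (g : int -> {freeg (int + int)}) (G : int -> M) :
  (forall a b, L (a + b) = L a + L b) ->
  (forall i, L (g i) = G i - G (i - 1)) ->
  forall i, L (partial_sum g i) = G i - G 0.
Proof.
move=> LD Lg.
pose D i := L (partial_sum g i) - G i.
have DS i : D (i + 1) = D i.
  by rewrite /D partial_sumS LD Lg addrK addrA addrAC addrK.
have D0 : D 0 = - G 0.
  by rewrite /D /= big_nil (_ : L 0 = 0) ?sub0r //; apply: (addIr (L 0));
    rewrite -LD addr0 add0r.
have DE i : D i = - G 0.
  rewrite -D0; elim/int_ind: i => [|n IHn|n IHn] //.
    by rewrite -addn1 PoszD DS.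
  by rewrite -DS -IHn; congr D; lia.
by move=> i; rewrite addrC -(DE i) subrK.
Qed.

(** * Twisted diagonals and indecomposability *)

(** A map y |-> op_(q y)(y) can be inverted as soon as the subscript op_(q y)
    can be recovered, by means of some q', from any value op_a(y): the
    preimage of z is then op_(q' z)^-1(z). *)
Lemma twist_bijective (T : Type) (op : T -> T -> T) (q q' : T -> T) :
  (forall a, bijective (op a)) -> (forall a y, op (q' (op a y)) = op (q y)) ->
  bijective (fun y => op (q y) y).
Proof.
move=> opbij opq.
have /choice[inv invP] a : exists g, cancel (op a) g /\ cancel g (op a).
  by have [g gK Kg] := opbij a; exists g.
exists (fun z => inv (q' z) z) => [y|z].
  have [invK _] := invP (q' (op (q y) y)).
  by rewrite -{2}(opq (q y) y) invK.
have [_ Kinv] := invP (q' z).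
by rewrite -(opq (q' z)) !Kinv.
Qed.

(** Stability of P is required in both directions because the permutation group
    also contains the inverses of sigma_x and tau_x. *)
Lemma indecomposable_ind (X : presolution) (P : X -> Prop) (x0 : X) :
  indecomposable X ->
  (forall x y, P (sigma x y) <-> P y) -> (forall x y, P (tau x y) <-> P y) ->
  P x0 -> forall x, P x.
Proof.
move=> indecX Ps Pt Px0 x; have [g gP <-] := indecX x0 x.
suff: forall y, P (g y) <-> P y by move=> ->.
elim: {x} g / gP => [y|||g h _ Pg _ Ph y|g h _ Pg gh hg y] //=.
  by rewrite Pg.
by rewrite -(Pg (h y)) hg.
Qed.

(** * Solutions of multipermutation level at most 2 *)

Section Level2.
Variables (X : presolution) (solX : solution X) (mplX : mpl_le2 X).
Implicit Types (x y a b : X).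

Lemma mpl_le2_sigma a b y : approx (sigma a y) (sigma b y).
Proof.
case: mplX => q qP.
pose p (u : X) : retract X := \pi_(retract X) (u : {classic X}).
have /eqmodP/asboolP[sab _] :
  \pi_(retract (Ret X)) (p a : {classic _}) =
  \pi_(retract (Ret X)) (p b : {classic _}) by rewrite [LHS]qP [RHS]qP.
have := congr1 (@^~ (p y)) sab.
by rewrite !(sigma_Ret solX) => /eqmodP.
Qed.

Lemma mpl_le2_tau a b y : approx (tau a y) (tau b y).
Proof.
case: mplX => q qP.
pose p (u : X) : retract X := \pi_(retract X) (u : {classic X}).
have /eqmodP/asboolP[_ tab] :
  \pi_(retract (Ret X)) (p a : {classic _}) =
  \pi_(retract (Ret X)) (p b : {classic _}) by rewrite [LHS]qP [RHS]qP.
have := congr1 (@^~ (p y)) tab.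
by rewrite !(tau_Ret solX) => /eqmodP.
Qed.

Local Notation "x ~ y" := (is_true (@approx X x y)) (at level 70).

Lemma approxP x y : x ~ y -> sigma x = sigma y /\ tau x = tau y.
Proof. by move/asboolP. Qed.

Lemma approxC x y : x ~ y -> y ~ x.
Proof. by rewrite approx_sym. Qed.

Lemma approxT x y z : x ~ y -> y ~ z -> x ~ z.
Proof. exact: approx_trans. Qed.

Lemma sigma_approx a b x y : x ~ y -> sigma a x ~ sigma b y.
Proof.
move=> xy; apply: approxT (mpl_le2_sigma a b x) _.
exact: (approx_op solX (approx_refl (b : {classic X})) xy).1.
Qed.

Lemma tau_approx a b x y : x ~ y -> tau a x ~ tau b y.
Proof.
move=> xy; apply: approxT (mpl_le2_tau a b x) _.
exact: (approx_op solX (approx_refl (b : {classic X})) xy).2.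
Qed.

Lemma ybe_level2 x y z :
  [/\ sigma x (sigma y z) = sigma (sigma x y) (sigma (tau y x) z),
      tau (sigma (tau y x) z) (sigma x y) = sigma (tau (sigma y z) x) (tau z y)
    & tau z (tau y x) = tau (tau z y) (tau (sigma y z) x)].
Proof. by case: solX => _ _ _ /ybeP. Qed.

Lemma sigma_inj a : injective (sigma a).
Proof. by case: solX => _ sbij _ _; apply: bij_inj. Qed.

Lemma tau_inj a : injective (tau a).
Proof. by case: solX => _ _ tbij _; apply: bij_inj. Qed.

(** The mixed component of the Yang-Baxter equation, read in the retract, where
    subscripts are immaterial: T S = S T. *)
Lemma tau_sigma_commute a b y : tau a (sigma b y) ~ sigma b (tau a y).
Proof.
have [_ e _] := ybe_level2 b y y.
apply: approxT (tau_approx a (sigma (tau y b) y) (approx_refl (sigma b y : {classic X}))) _.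
rewrite e; apply: sigma_approx; apply: tau_approx; exact: approx_refl.
Qed.

(** T S = 1 on the retract.  For x = sigma_y(y) the equation
    sigma_x sigma_y = sigma_(sigma_x y) sigma_(tau_y x) has equal outer factors
    on both sides, since sigma_x(y) ~ sigma_y(y) = x; cancelling them leaves
    sigma_y = sigma_(tau_y(sigma_y y)).  The same argument for tau gives
    tau_y = tau_(sigma_y(tau_y y)), and T S = S T turns this into the required
    equality. *)
Lemma tau_sigma a b y : tau a (sigma b y) ~ y.
Proof.
have sE : sigma (tau a (sigma b y)) = sigma y.
  have /approxP[-> _] : tau a (sigma b y) ~ tau y (sigma y y).
    by apply: tau_approx; apply: mpl_le2_sigma.
  apply: funext => z; apply: (@sigma_inj (sigma y y)).
  have [-> _ _] := ybe_level2 (sigma y y) y z.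
  by have /approxP[-> _] := mpl_le2_sigma (sigma y y) y y.
have tE : tau (tau a (sigma b y)) = tau y.
  have /approxP[_ ->] : tau a (sigma b y) ~ sigma y (tau y y).
    apply: approxT (tau_sigma_commute _ _ _) _.
    by apply: sigma_approx; apply: mpl_le2_tau.
  apply: funext => x; apply: (@tau_inj (tau y y)).
  have [_ _ ->] := ybe_level2 x y (tau y y).
  by have /approxP[_ ->] := mpl_le2_tau (tau y y) y y.
by apply/asboolP.
Qed.

Lemma sigma_tau a b y : sigma a (tau b y) ~ y.
Proof. exact: approxT (approxC (tau_sigma_commute b a y)) (tau_sigma b a y). Qed.

(** A map X -> X that induces S^k on the retract.  For k < 0 it uses that tau
    induces the inverse of S. *)
Definition shift k x : X :=
  match k with
  | Posz n => iter n (fun y => sigma y y) x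
  | Negz n => iter n.+1 (fun y => tau y y) x
  end.

Lemma shift_approx k x y : x ~ y -> shift k x ~ shift k y.
Proof.
move=> xy; case: k => n /=.
  by elim: n => //= n IHn; apply: sigma_approx.
by apply: tau_approx; elim: n => //= n IHn; apply: tau_approx.
Qed.

Lemma shift_succ a k x : shift (k + 1) x ~ sigma a (shift k x).
Proof.
case: k => [n|[|n]].
- by rewrite -PoszD addn1; apply: mpl_le2_sigma.
- exact: approxC (sigma_tau _ _ _).
- rewrite (_ : Negz n.+1 + 1 = Negz n); last by lia.
  exact: approxC (sigma_tau _ _ _).
Qed.

Lemma shift_pred a k x : shift (k - 1) x ~ tau a (shift k x).
Proof.
have := shift_succ x (k - 1) x; rewrite subrK => /(tau_approx a a) e.
exact: approxC (approxT e (tau_sigma _ _ _)).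
Qed.

Lemma shiftD k l x : shift (k + l) x ~ shift k (shift l x).
Proof.
elim/int_ind: k => [|n IHn|n IHn]; first by rewrite add0r; apply: approx_refl.
  rewrite -addn1 PoszD addrAC; apply: approxT (shift_succ x _ _) _.
  apply: approxT (sigma_approx x x IHn) _.
  exact: approxC (shift_succ x _ _).
rewrite (_ : - n.+1%:Z = - n%:Z - 1) 1?addrAC; last by lia.
apply: approxT (shift_pred x _ _) _.
apply: approxT (tau_approx x x IHn) _.
exact: approxC (shift_pred x _ _).
Qed.

Lemma shift_sigma k a x : shift k (sigma a x) ~ shift (k + 1) x.
Proof.
apply: approxC; apply: approxT (shiftD k 1 x) _; apply: shift_approx.
exact: mpl_le2_sigma.
Qed.

Lemma shift_tau k a x : shift k (tau a x) ~ shift (k - 1) x.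
Proof.
apply: approxC; apply: approxT (shiftD k (-1) x) _; apply: shift_approx.
exact: mpl_le2_tau.
Qed.

(** On the retract every sigma_x is S and every tau_x its inverse, so that a
    transitive group generated by them leaves a single orbit of S. *)
Lemma indecomposable_shift (indecX : indecomposable X) x0 x :
  exists n, x ~ shift n x0.
Proof.
move: x; apply: (indecomposable_ind (x0 := x0) indecX) => [x y|x y|].
- split=> -[n yn].
    exists (n - 1); apply: approxT (approxC (tau_sigma x x y)) _.
    apply: approxT (tau_approx x x yn) _.
    exact: approxC (shift_pred _ _ _).
  exists (n + 1); apply: approxT (sigma_approx x x yn) _.
  exact: approxC (shift_succ _ _ _).
- split=> -[n yn].
    exists (n + 1); apply: approxT (approxC (sigma_tau x x y)) _.
    apply: approxT (sigma_approx x x yn) _.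
    exact: approxC (shift_succ _ _ _).
  exists (n - 1); apply: approxT (tau_approx x x yn) _.
  exact: approxC (shift_pred _ _ _).
- by exists 0; apply: approx_refl.
Qed.

(** The maps B_i (left summand) and E_i (right summand). *)
Definition twist (k : int + int) (y : X) : X :=
  match k with
  | inl i => sigma (shift i y) y
  | inr i => tau (shift i y) y
  end.

Lemma twist_bij k : bijective (twist k).
Proof.
case: solX => _ sbij tbij _; case: k => i.
  apply: (@twist_bijective X (@sigma X) (shift i) (shift (i - 1)) sbij) => a y.
  by have /approxP[-> _] := shift_sigma (i - 1) a y; rewrite subrK.
apply: (@twist_bijective X (@tau X) (shift i) (shift (i + 1)) tbij) => a y.
by have /approxP[_ ->] := shift_tau (i + 1) a y; rewrite addrK.
Qed.

(** At y, the composite B_i B_j is sigma_u sigma_v with u ~ S^(i+1) y and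
    v ~ S^j y.  The Yang-Baxter equation rewrites it with subscripts
    sigma_u(v) ~ S^(j+1) y and tau_v(u) ~ S^i y, which is B_j B_i. *)
Lemma twist_sigma_sigma i j y :
  twist (inl i) (twist (inl j) y) = twist (inl j) (twist (inl i) y).
Proof.
rewrite /twist.
have /approxP[-> _] := shift_sigma i (shift j y) y.
have /approxP[-> _] := shift_sigma j (shift i y) y.
have [-> _ _] := ybe_level2 (shift (i + 1) y) (shift j y) y.
have /approxP[<- _] := shift_succ (shift (i + 1) y) j y.
have /approxP[<- _] := shift_pred (shift j y) (i + 1) y.
by rewrite addrK.
Qed.

(** As for B_i B_j, with S replaced by its inverse. *)
Lemma twist_tau_tau i j y :
  twist (inr i) (twist (inr j) y) = twist (inr j) (twist (inr i) y).
Proof.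
rewrite /twist.
have /approxP[_ ->] := shift_tau i (shift j y) y.
have /approxP[_ ->] := shift_tau j (shift i y) y.
have [_ _ ->] := ybe_level2 y (shift j y) (shift (i - 1) y).
have /approxP[_ <-] := shift_pred (shift (i - 1) y) j y.
have /approxP[_ <-] := shift_succ (shift j y) (i - 1) y.
by rewrite subrK.
Qed.

(** The mixed component of the Yang-Baxter equation, with subscripts in the
    classes of S^(i+1) y, S^j y on one side and S^(j-1) y, S^i y on the other. *)
Lemma twist_tau_sigma i j y :
  twist (inr i) (twist (inl j) y) = twist (inl j) (twist (inr i) y).
Proof.
rewrite /twist.
have /approxP[_ ->] := shift_sigma i (shift j y) y.
have /approxP[-> _] := shift_tau j (shift i y) y.
have [_ e _] := ybe_level2 (shift j y) y (shift i y).
have /approxP[_ ->] :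
    shift (i + 1) y ~ sigma (tau y (shift j y)) (shift i y) by apply: shift_succ.
rewrite e.
by have /approxP[<- _] := shift_pred (sigma y (shift i y)) j y.
Qed.

Lemma twist_commute k : centralizes twist (twist k).
Proof.
move=> l y; case: k l => i [] j.
- exact: twist_sigma_sigma.
- exact/esym/twist_tau_sigma.
- exact: twist_tau_sigma.
- exact: twist_tau_tau.
Qed.

(** The effect on the retract: a map of degree d induces S^d there.  When S has
    finite order the degree is determined only modulo that order, hence a
    relation and not a function. *)
Definition has_degree (g : X -> X) (d : int) : Prop := forall x, g x ~ shift d x.

Lemma twist_degree k :
  has_degree (twist k) (match k with inl _ => 1 | inr _ => -1 end).
Proof. by case: k => i y /=; [apply: mpl_le2_sigma | apply: mpl_le2_tau]. Qed.

Section Action.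
Variables (M : zmodType) (act : M -> X -> X).
Hypotheses (act0 : forall x, act 0 x = x)
  (actD : forall m n x, act (m + n) x = act m (act n x)).

Lemma act_degree0 : has_degree (act 0) 0.
Proof. by move=> x; rewrite act0; apply: approx_refl. Qed.

Lemma act_degreeD m n d e : has_degree (act m) d -> has_degree (act n) e ->
  has_degree (act (m + n)) (d + e).
Proof.
move=> md ne x; rewrite actD; apply: approxT (md _) _.
exact: approxT (shift_approx d (ne x)) (approxC (shiftD _ _ _)).
Qed.

Lemma act_degreeN m d : has_degree (act m) d -> has_degree (act (- m)) (- d).
Proof.
move=> md x; apply: approxC.
rewrite -[x in shift _ x](act0 x) -(subrr m) actD.
apply: approxT (shift_approx (- d) (md _)) _.
by apply: approxT (approxC (shiftD _ _ _)) _; rewrite addNr; apply: approx_refl.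
Qed.

Lemma act_degreeMz m d (n : int) :
  has_degree (act m) d -> has_degree (act (m *~ n)) (d * n).
Proof.
move=> md; elim/int_ind: n => [|n IHn|n IHn].
- by rewrite mulr0z mulr0; apply: act_degree0.
- by rewrite intS mulrzDr mulr1z mulrDr mulr1; apply: act_degreeD.
- rewrite intS opprD mulrzDr mulrN1z mulrDr mulrN1.
  by apply: act_degreeD => //; apply: act_degreeN.
Qed.

End Action.
End Level2.

(** * The map from the universal solution *)

Theorem proposition6p7 (X : presolution) (solX : solution X)
    (indecX : indecomposable X) (mplX : mpl_le2 X) :
  exists Phi : universal_solution -> X,
    homomorphism Phi /\ (forall x : X, exists y : universal_solution, Phi y = x).
Proof.
have [[x0] sbij tbij _] := solX.
have [M [act [gen [act0 actD actg]]]] :=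
  commuting_permutations_zmod (twist_bij solX mplX) (twist_commute solX mplX).
pose B i := gen (inl i); pose E i := gen (inr i).
have [L [LD LU Lind]] := freeg_lift (fun k : int + int =>
  match k with
  | inl i => B (i + 1) - B i
  | inr i => E (i - 1) - E (i - 1 - 1)
  end).
have Lc i : L (offset_c i) = B (i + 1) - B 1.
  apply: (@partial_sum_telescope M L basis_e (fun i => B (i + 1))) => // j.
  by rewrite LU subrK.
have Ld i : L (offset_d i) = E (i - 1) - E (-1).
  apply: (@partial_sum_telescope M L basis_f (fun i => E (i - 1))) => // j.
  by rewrite LU.
(* The terms B 1 and E (-1) account for the basis steps in Z^2: c_0 = d_0 = 0,
   so these steps are the twists with k - 1 = 0 and k + 1 = 0. *)
pose W (y : universal_solution) : M :=
  let: (b, (j, j')) := y in L b + B 1 *~ j + E (-1) *~ j'.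
pose deg (y : universal_solution) : int := let: (b, (j, j')) := y in j - j'.
pose Phi y := act (W y) x0.
have PhiE y : approx (Phi y) (shift (deg y) x0).
  case: y => b [j j']; rewrite /Phi /W /deg.
  have Bdeg i : has_degree (act (B i)) 1.
    by rewrite actg; apply: twist_degree mplX (inl i).
  have Edeg i : has_degree (act (E i)) (-1).
    by rewrite actg; apply: twist_degree mplX (inr i).
  have degB m n d e : has_degree (act m) d -> has_degree (act n) e ->
      has_degree (act (m - n)) (d - e).
    move=> md ne; apply: (act_degreeD solX mplX actD) => //.
    exact: (act_degreeN solX mplX act0 actD).
  have Lb : has_degree (act (L b)) 0.
    apply: (Lind (fun m => has_degree (act m) 0)).
    - exact: act_degree0.
    - by move=> m n; apply: (degB m n 0 0).
    - by case=> i; [apply: (degB _ _ 1 1) | apply: (degB _ _ (-1) (-1))].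
  have -> : j - j' = 0 + 1 * j + -1 * j' by lia.
  apply: (act_degreeD solX mplX actD).
    by apply: (act_degreeD solX mplX actD) => //;
      apply: (act_degreeMz solX mplX act0 actD).
  exact: (act_degreeMz solX mplX act0 actD).
have PhiS y z : approx (shift (deg y - deg z) (Phi z)) (Phi y).
  apply: approxT (shift_approx solX mplX _ (PhiE z)) _.
  apply: approxT (approxC (shiftD solX mplX _ _ _)) _.
  by rewrite subrK; apply: approxC.
have Phi_sigma y z : Phi (sigma y z) = sigma (Phi y) (Phi z).
  have /approxP[<- _] := PhiS y z.
  (* With this subscript sigma acts on Phi z as B_k, so that both sides are
     images of x0 under elements of M. *)
  rewrite -[RHS]/(twist (inl _) _) -actg -actD.
  congr (act _ x0); case: y z => [a [i i']] [b [j j']] /=.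
  rewrite LD Lc mulrzDr mulr1z.
  have -> : i - i' + j' - j - 1 + 1 = i - i' - (j - j') by lia.
  by rewrite addrACA subrK [RHS]addrC [LHS]addrAC.
have Phi_tau y z : Phi (tau y z) = tau (Phi y) (Phi z).
  have /approxP[_ <-] := PhiS y z.
  rewrite -[RHS]/(twist (inr _) _) -actg -actD.
  congr (act _ x0); case: y z => [a [i i']] [b [j j']] /=.
  rewrite LD Ld mulrzDr mulr1z.
  have -> : i - i' + j' - j + 1 - 1 = i - i' - (j - j') by lia.
  by rewrite [L b + _ + _]addrAC addrACA subrK [RHS]addrC.
exists Phi; split=> //.
have degX := indecomposable_shift solX mplX indecX x0.
have Phi_approx x : exists y, approx x (Phi y).
  have [n xn] := degX x.
  exists ((0, (n, 0)) : universal_solution).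
  apply: approxT xn (approxC _).
  by have := PhiE (0, (n, 0)); rewrite /deg subr0.
(* By Phi_approx every sigma_x and tau_x is a sigma_(Phi y) and a tau_(Phi y);
   the image is stable under their inverses because the operations of the
   universal solution are surjective. *)
have [_ ubij vbij _] := universal_solutionP.
apply: (indecomposable_ind (x0 := x0) indecX) => [x z|x z|].
- have [y /approxP[-> _]] := Phi_approx x.
  split=> [[w wE]|[w <-]]; last by exists (sigma y w).
  have [v _ vK] := ubij y.
  exists (v w); apply: (bij_inj (sbij (Phi y))).
  by rewrite -Phi_sigma vK.
- have [y /approxP[_ ->]] := Phi_approx x.
  split=> [[w wE]|[w <-]]; last by exists (tau y w).
  have [v _ vK] := vbij y.
  exists (v w); apply: (bij_inj (tbij (Phi y))).
  by rewrite -Phi_tau vK.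
- exists ((0, (0, 0)) : universal_solution); rewrite /Phi /W.
  suff -> : L 0 = 0 by rewrite !mulr0z !addr0 act0.
  by apply: (addIr (L 0)); rewrite -LD addr0 add0r.
Qed.
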